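(* Let $n\ge2$ and $y_1,\dots,y_n>0$. Let $\mathcal{P}=\mathcal{P}(y)\subset\mathbb{R}^{n-1}$ be the set of $x=(x_1,\dots,x_{n-1})$ satisfying $$y_{j+1}+\dots+y_{k-1}\le x_j+\dots+x_{k-1}\le y_j+\dots+y_k\quad\text{for all }1\le j<k\le n$$ (an empty sum being $0$). Let $e_1,\dots,e_{n-1}$ be the standard basis of $\mathbb{R}^{n-1}$, $w=(y_2,\dots,y_n)$, $v_1=e_1$, $v_j=e_j-e_{j-1}$ for $2\le j\le n-1$, and $v_n=-e_{n-1}$. Let $\mathcal{Q}$ be the set of points $w+t_1y_1v_1+\dots+t_ny_nv_n$ with $0\le t_1,\dots,t_n\le1$, and for $j\in\{1,\dots,n\}$ let $\mathcal{Q}_j$ be the set of such points with $t_j=0$ (the other $t_i\in[0,1]$). Then $\mathcal{Q}=\mathcal{P}$, $\bigcup_{j=1}^n\mathcal{Q}_j=\mathcal{Q}$, and for $j\ne k$ the intersection $\mathcal{Q}_j\cap\mathcal{Q}_k$ is contained in an $(n-2)$-dimensional cone in $\mathbb{R}^{n-1}$. *)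

(* Defs.v *)
From mathcomp Require Import all_boot all_order all_algebra.
From mathcomp Require Import boolp classical_sets reals.

Set Implicit Arguments.
Unset Strict Implicit.
Unset Printing Implicit Defensive.

Import Order.TTheory GRing.Theory Num.Theory.

Local Open Scope classical_set_scope.
Local Open Scope ring_scope.

(* Indices are 0-based: the mathematical y_1, ..., y_n are y 0, ..., y (n-1)
   for y : 'I_n -> R, and a point of R^(n-1) is a row vector with entries
   x_1, ..., x_(n-1) at positions 0, ..., n-2. *)

Section Zonotope.
Variables (R : realType) (n : nat).
Implicit Type y t : 'I_n -> R.

Definition polytopeP y : set 'rV[R]_n.-1 :=
  [set x : 'rV[R]_n.-1 | forall j k : 'I_n, (j < k)%N ->
     \sum_(i < n | (j < i < k)%N) y i
       <= \sum_(i < n.-1 | (j <= i < k)%N) x 0 i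
       <= \sum_(i < n | (j <= i <= k)%N) y i].

Definition ordS_pred (i : 'I_n.-1) : 'I_n :=
  Ordinal (etrans (esym (ltn_predRL i n)) (ltn_ord i)).

Definition base_w y : 'rV[R]_n.-1 := \row_i y (ordS_pred i).

(* Indexed by nat rather than by 'I_n.-1, so that the vectors vec_v below need
   no ordinal casts. *)
Definition basis_e (k : nat) : 'rV[R]_n.-1 := \row_i (i == k :> nat)%:R.

Definition vec_v (j : 'I_n) : 'rV[R]_n.-1 :=
  if j == 0%N :> nat then basis_e 0
  else if j == n.-1 :> nat then - basis_e n.-2
  else basis_e j - basis_e j.-1.

Definition zono_point y t : 'rV[R]_n.-1 :=
  base_w y + \sum_(i < n) (t i * y i) *: vec_v i.

Definition zonotopeQ y : set 'rV[R]_n.-1 :=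
  [set x : 'rV[R]_n.-1 | exists2 t, (forall i, 0 <= t i <= 1) & x = zono_point y t].

Definition zonotopeQj y (j : 'I_n) : set 'rV[R]_n.-1 :=
  [set x : 'rV[R]_n.-1 | exists t, [/\ forall i, 0 <= t i <= 1, t j = 0
                       & x = zono_point y t]].

End Zonotope.

Section Cones.
Variables (R : realType) (N : nat).

(* The cone with apex p generated by the rows of V; its affine hull is p plus
   the row space of V, so its dimension is \rank V. *)
Definition cone_gen m (p : 'rV[R]_N) (V : 'M[R]_(m, N)) : set 'rV[R]_N :=
  [set p + c *m V | c in [set c : 'rV[R]_m | forall i, 0 <= c 0 i]].

(* A cone with arbitrary apex containing no line through it; without the latter
   condition every affine subspace would be a cone. *)
Definition is_cone_of_dim (d : nat) (C : set 'rV[R]_N) : Prop :=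
  exists (m : nat) (p : 'rV[R]_N) (V : 'M[R]_(m, N)),
    [/\ C = cone_gen p V,
        forall u : 'rV[R]_N, C (p + u) -> C (p - u) -> u = 0
      & \rank V = d].

End Cones.

(* Main.v *)
(** Write [S_i = \sum_(l < i) (x_l - y_(l+1))].  Then [x = w + \sum_i u_i v_i]
holds iff [u_i + S_i] does not depend on [i], whereas [x] lies in [P] iff
[S_j - S_i <= y_i] for all [i] and [j].  Hence for [x] in [P] the choice
[u_i = max S - S_i] satisfies [0 <= u_i <= y_i] and vanishes at the index where
[S] is maximal.  If [x] lies in [Q_j] and [Q_k], the two coefficient families
differ by a constant which is both nonnegative and nonpositive, so they agree
and [x] lies in the cone with apex [w] generated by the [v_i] with
[i != j, k]; these are independent because the only relation between the [v_i]
is [\sum_i v_i = 0]. *)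

Require Import Defs.
From mathcomp Require Import all_boot all_order all_algebra.
From mathcomp Require Import boolp classical_sets reals.
From mathcomp Require Import lra.

Set Implicit Arguments.
Unset Strict Implicit.
Unset Printing Implicit Defensive.

Import Order.TTheory GRing.Theory Num.Theory.
Local Open Scope classical_set_scope.
Local Open Scope ring_scope.

Lemma big_ord_interval (V : nmodType) (N j k : nat) (F : nat -> V) :
  (k <= N)%N -> \sum_(i < N | (j <= i < k)%N) F i = \sum_(j <= i < k) F i.
Proof.
move=> kN; rewrite -(big_mkord (fun i => j <= i < k)%N).
rewrite (big_nat_widen _ _ _ _ _ kN) (big_nat_widenl j 0%N) //.
by apply: eq_bigl => i; rewrite andbC.
Qed.

Section Coordinates.
Variables (R : realType) (m : nat).
Implicit Types (y u : 'I_m.+2 -> R) (x : 'rV[R]_m.+1).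

(** These are the [S_i] of the overview. Indexing by [nat] through [inord] lets the sums split and
    telescope; for [i <= m.+1] every [inord] stays in range. *)
Definition excess y x (i : nat) : R :=
  \sum_(0 <= l < i) (x 0 (inord l) - y (inord l.+1)).

(** The three cases merge into [e_i - e_(i-1)]: as [l] is at most [m], the first indicator vanishes
    for [i = m.+1] and the second for [i = 0]. *)
Lemma vec_vE (i : 'I_m.+2) (l : 'I_m.+1) :
  vec_v R i 0 l = (i == l :> nat)%:R - (i == l.+1 :> nat)%:R.
Proof.
have lm := ltn_ord l.
rewrite /vec_v /basis_e; case: eqP => [->|/eqP i0].
  by rewrite !mxE subr0 eq_sym.
case: eqP => [->|_].
  by rewrite !mxE /= eqSS [m == l]eq_sym (gtn_eqF lm) sub0r.
rewrite !mxE (eq_sym (l : nat)) -[in i == l.+1 :> nat](prednK (n := i)) ?lt0n //.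
by rewrite eqSS (eq_sym (l : nat)).
Qed.

Lemma sum_vec_vE u (l : 'I_m.+1) :
  (\sum_i u i *: vec_v R i) 0 l = u (inord l) - u (inord l.+1).
Proof.
have pick k : (k < m.+2)%N -> \sum_(i < m.+2) u i * (i == k :> nat)%:R = u (inord k).
  move=> km; rewrite (bigD1 (inord k)) //= inordK // eqxx mulr1 big1 ?addr0 //.
  move=> i ik; case: eqP => [e|_]; last by rewrite mulr0.
  by rewrite -e inord_val eqxx in ik.
have lm := ltn_ord l.
rewrite summxE -(pick l) ?(ltnW lm) 1?ltnW // -(pick l.+1) //.
by rewrite -sumrB; apply: eq_bigr => i _; rewrite mxE vec_vE mulrBr.
Qed.

Lemma excessB y x (j k : nat) : (j <= k)%N ->
  excess y x k - excess y x j
  = \sum_(j <= l < k) (x 0 (inord l) - y (inord l.+1)).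
Proof. by move=> jk; rewrite /excess (big_cat_nat _ jk) //= [X in X - _]addrC addrK. Qed.

(** Coordinate [l] of the vector equation reads [x_l - y_(l+1) = u_l - u_(l+1)], that is, [u + S]
    takes the same value at [l] and [l+1]. *)
Lemma base_w_addE y u x :
  x = base_w y + \sum_i u i *: vec_v R i <->
  forall i j : 'I_m.+2, u i + excess y x i = u j + excess y x j.
Proof.
have wE l : (base_w y + \sum_i u i *: vec_v R i) 0 l
    = y (inord l.+1) + (u (inord l) - u (inord l.+1)).
  rewrite mxE sum_vec_vE mxE; congr (y _ + _).
  by apply: val_inj; rewrite /= inordK // ltnS.
split=> [xE|uE].
  suff u0E (i : 'I_m.+2) : u i + excess y x i = u (inord 0) by move=> i j; rewrite !u0E.
  have -> : excess y x i = - \sum_(0 <= l < i) (u (inord l.+1) - u (inord l)).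
    rewrite -sumrN; apply: eq_big_nat => l /andP[_ li].
    rewrite xE wE inordK; last by rewrite (leq_trans li) // -ltnS.
    by rewrite addrC addKr opprB.
  by rewrite telescope_sumr // inord_val opprB addrC subrK.
apply/rowP => l; rewrite wE; have lm := ltn_ord l.
have := uE (inord l) (inord l.+1); rewrite !inordK ?ltnS // 1?ltnW //.
rewrite {2}/excess big_nat_recr //= -/(excess y x l) inord_val; lra.
Qed.

(** Subtract [y_(j+1) + ... + y_k] from all three members of the chain. *)
Lemma polytopePE y x : polytopeP y x <->
  forall j k : 'I_m.+2, (j < k)%N ->
    - y k <= excess y x k - excess y x j <= y j.
Proof.
suff E (j k : 'I_m.+2) : (j < k)%N ->
   (\sum_(i < m.+2 | (j < i < k)%N) y i
       <= \sum_(i < m.+1 | (j <= i < k)%N) x 0 i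
       <= \sum_(i < m.+2 | (j <= i <= k)%N) y i)
   = (- y k <= excess y x k - excess y x j <= y j).
  by split=> H j k jk; [rewrite -E //|rewrite E //]; apply: H.
move=> jk; have km := ltn_ord k.
have yE (P : pred nat) : \sum_(i < m.+2 | P i) y i = \sum_(i < m.+2 | P i) y (inord i).
  by apply: eq_bigr => i _; rewrite inord_val.
rewrite excessB 1?ltnW // sumrB.
rewrite (yE (fun i => j < i < k)%N) (yE (fun i => j <= i <= k)%N).
rewrite (eq_bigr (fun i : 'I_m.+1 => x 0 (inord i))); last by move=> i _; rewrite inord_val.
rewrite (@big_ord_interval _ m.+2 j.+1 k (fun i => y (inord i))) 1?ltnW //.
rewrite (@big_ord_interval _ m.+1 j k (fun i => x 0 (inord i))) -1?ltnS //.
rewrite (@big_ord_interval _ m.+2 j k.+1 (fun i => y (inord i))) //.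
(* Once the shift [l.+1] is absorbed, each sum of [y] differs from the one over [j < i < k] only by
   [y j] or [y k]. *)
rewrite -[X in _ - X](big_add1 _ _ j k.+1 xpredT (fun i => y (inord i))) /=.
rewrite (@big_ltn _ _ _ j k.+1) ?ltnS 1?ltnW //.
rewrite !(big_nat_recr _ _ _ jk) /= !inord_val.
set a := \sum_(_ <= _ < _) _; set b := \sum_(_ <= _ < _) _.
by apply/idP/idP => /andP[h1 h2]; apply/andP; split; lra.
Qed.

Lemma zono_pointE y u x :
  x = zono_point y u <->
  forall i j : 'I_m.+2, u i * y i + excess y x i = u j * y j + excess y x j.
Proof. exact: (base_w_addE y (fun i => u i * y i)). Qed.

(** With [u_i = t_i y_i], constancy of [u + S] gives [S_k - S_j = u_j - u_k], where
    [0 <= u_i <= y_i]. *)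
Lemma zonotopeQ_sub_P y : (forall i, 0 < y i) -> zonotopeQ y `<=` polytopeP y.
Proof.
move=> y0 x [t t01 /zono_pointE tE]; apply/polytopePE => j k _.
have u01 i : 0 <= t i * y i <= y i.
  have /andP[t0 t1] := t01 i.
  by rewrite mulr_ge0 ?(ltW (y0 i)) //= ler_piMl // ltW.
have := tE j k; move: (u01 j) (u01 k) => /andP[? ?] /andP[? ?] ?.
by apply/andP; split; lra.
Qed.

Lemma polytopeP_sub_Qj y : (forall i, 0 < y i) ->
  polytopeP y `<=` \bigcup_(j in [set: 'I_m.+2]) zonotopeQj y j.
Proof.
move=> y0 x /polytopePE xP; pose S (i : 'I_m.+2) := excess y x i.
have [j _ Smax] : exists2 j, true & forall i, S i <= S j.
  by case: (@arg_maxP _ R _ ord0 xpredT S) => // j _ Sj; exists j => // i; apply: Sj.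
(* The upper bound in [polytopePE] settles [i < j], the lower bound [j < i]. *)
have Sy i : S j - S i <= y i.
  case: (ltngtP i j) => [ij|ji|/val_inj ->].
  - by case/andP: (xP _ _ ij).
  - by case/andP: (xP _ _ ji) => + _; rewrite -/(S i) -/(S j) => ?; lra.
  - by rewrite subrr ltW.
exists j => //; exists (fun i => (S j - S i) / y i); split.
- by move=> i; rewrite divr_ge0 ?subr_ge0 ?(ltW (y0 i)) //= ler_pdivrMr ?mul1r.
- by rewrite subrr mul0r.
- apply/zono_pointE => i k; rewrite !divfK ?gt_eqF //.
  by rewrite -/(S i) -/(S k) !subrK.
Qed.

(** This is [base_w_addE] at [y = 0] and [x = 0], where every [S_i] vanishes. *)
Lemma vec_v_relation u :
  \sum_i u i *: vec_v R i = 0 -> forall i j, u i = u j.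
Proof.
move=> u0 i j.
have ex0 k : excess (fun=> 0) 0 k = 0.
  by rewrite /excess big1 // => l _; rewrite mxE subrr.
have /base_w_addE/(_ i j) : 0 = base_w (fun=> 0) + \sum_i u i *: vec_v R i.
  by rewrite u0 addr0; apply/rowP => l; rewrite !mxE.
by rewrite !ex0 !addr0.
Qed.

Definition vec_v_mx (A : {set 'I_m.+2}) : 'M[R]_(#|A|, m.+1) :=
  \matrix_a vec_v R (enum_val a).

Lemma mul_vec_v_mx (A : {set 'I_m.+2}) u :
  (\row_a u (enum_val a)) *m vec_v_mx A = \sum_(i in A) u i *: vec_v R i.
Proof.
rewrite mulmx_sum_row [RHS]big_enum_val; apply: eq_bigr => a _.
by rewrite mxE rowK.
Qed.

(** A relation among the rows extends by zero to one among all [v_i]; its coefficients are all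
    equal, and the one at some [k] outside [A] is zero. *)
Lemma vec_v_mx_free (A : {set 'I_m.+2}) : A != [set: 'I_m.+2]%SET ->
  row_free (vec_v_mx A).
Proof.
move=> AT; apply: inj_row_free => c cV.
have [k kA] : exists k, k \notin A.
  by apply/existsP; rewrite -negb_forall; apply: contra AT => /forallP AT;
     apply/eqP/setP => i; rewrite inE AT.
(* The extension of [c] by zero: [enum_val] is injective, so the sum has at most one term. *)
pose u i := \sum_(a | enum_val a == i) c 0 a.
have uA a : u (enum_val a) = c 0 a.
  rewrite /u (eq_bigl (pred1 a)) ?big_pred1_eq // => b.
  exact: (inj_eq enum_val_inj).
have uNA i : i \notin A -> u i = 0.
  move=> iA; apply: big1 => a /eqP ai.
  by rewrite -ai enum_valP in iA.
have cE : c = \row_a u (enum_val a) by apply/rowP => a; rewrite mxE uA.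
have u0 : \sum_i u i *: vec_v R i = 0.
  rewrite -[RHS]cV cE mul_vec_v_mx [RHS]big_mkcond /=; apply: eq_bigr => i _.
  by case: ifPn => // /uNA ->; rewrite scale0r.
by apply/rowP => a; rewrite mxE -uA (vec_v_relation u0 _ k) uNA.
Qed.

(** Comparing indices [j] and [k] in both representations gives [t_k y_k = S_j - S_k = - s_j y_j],
    so both products vanish. *)
Lemma zonotopeQjI y (j k : 'I_m.+2) x : (forall i, 0 < y i) ->
  zonotopeQj y j x -> zonotopeQj y k x ->
  exists t, [/\ forall i, 0 <= t i, t j = 0, t k = 0 & x = zono_point y t].
Proof.
move=> y0 [t [t01 tj xt]] [s [s01 sk xs]].
exists t; split=> //; first by move=> i; case/andP: (t01 i).
have /zono_pointE/(_ j k) := xt; have /zono_pointE/(_ j k) := xs.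
rewrite tj sk !mul0r => e1 e2.
have sj0 : 0 <= s j * y j by rewrite mulr_ge0 ?(ltW (y0 j)) //; case/andP: (s01 j).
have tk0 : 0 <= t k * y k by rewrite mulr_ge0 ?(ltW (y0 k)) //; case/andP: (t01 k).
have /eqP : t k * y k = 0 by lra.
by rewrite mulf_eq0 (gt_eqF (y0 k)) orbF => /eqP.
Qed.

End Coordinates.

(** If [c] and [c'] represent [u] and [- u], freeness forces [c + c' = 0], and nonnegativity then
    gives [c = 0]. *)
Lemma cone_gen_free (R : realType) (N d : nat) (p : 'rV[R]_N) (V : 'M[R]_(d, N)) :
  row_free V -> is_cone_of_dim d (cone_gen p V).
Proof.
move=> Vfree; exists d, p, V; split=> //; last exact/eqP.
move=> u [c c0 /addrI cu] [c' c0' /addrI cu'].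
have /eqP : (c + c') *m V = 0 by rewrite mulmxDl cu cu' subrr.
rewrite mulmx_free_eq0 // => /eqP cc'.
rewrite -cu; suff -> : c = 0 by rewrite mul0mx.
apply/rowP => i; have /rowP/(_ i) := cc'; rewrite !mxE => e.
by have := c0 i; have := c0' i; lra.
Qed.

Theorem theorem7p1 (R : realType) (n : nat) (hn : (2 <= n)%N)
    (y : 'I_n -> R) (hy : forall i : 'I_n, 0 < y i) :
  [/\ zonotopeQ y = polytopeP y,
      \bigcup_(j in [set: 'I_n]) zonotopeQj y j = zonotopeQ y
    & forall j k : 'I_n, j != k ->
        exists2 C : set 'rV[R]_n.-1,
          is_cone_of_dim (n - 2) C & zonotopeQj y j `&` zonotopeQj y k `<=` C].
Proof.
case: n hn y hy => [|[|m]] // _ y hy.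
have QjQ : \bigcup_(j in [set: 'I_m.+2]) zonotopeQj y j `<=` zonotopeQ y.
  by move=> x [j _ [t [t01 _ ->]]]; exists t.
have QP := zonotopeQ_sub_P hy; have PQj := polytopeP_sub_Qj hy.
split.
- by apply/seteqP; split=> //; apply: subset_trans PQj QjQ.
- by apply/seteqP; split=> //; apply: subset_trans QP PQj.
(* Deleting [j] and [k] leaves [n - 2] generators, independent since [A] is proper. *)
move=> j k jk; pose A := (~: [set j; k])%SET.
have cardA : #|A| = (m.+2 - 2)%N by rewrite cardsCs finset.setCK card_ord cards2 jk.
exists (cone_gen (base_w y) (vec_v_mx R A)).
  rewrite -cardA; apply/cone_gen_free/vec_v_mx_free.
  by apply/eqP => /setP/(_ j); rewrite !inE eqxx.
move=> x [xj /(zonotopeQjI hy xj)[t [t0 tj tk ->]]].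
pose u i := t i * y i; exists (\row_a u (enum_val a)).
  by rewrite /mkset => a; rewrite mxE mulr_ge0 // ltW.
rewrite mul_vec_v_mx /u /zono_point; congr (_ + _).
rewrite big_mkcond; apply: eq_bigr => i _; rewrite !inE negb_or.
case: eqP => [->|_] /=; first by rewrite tj mul0r scale0r.
by case: eqP => [->|//] /=; rewrite tk mul0r scale0r.
Qed.
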